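(* Let $m\ge 3$. For any real numbers $C\ge 1$ and $\varepsilon>0$, there exists an entire spacelike stationary graph in $\mathbb{R}^{2+m}_1$ generated by some smooth $f:\mathbb{R}^2\to\mathbb{R}^m_1$, whose $W$-function satisfies $\inf W\cdot\sup W=C$ and $0<\sup W-\inf W<\varepsilon$.
   Context: $\mathbb{R}^m_1$ denotes $\mathbb{R}^m$ with the Minkowski inner product $\langle \mathbf{u},\mathbf{v}\rangle=u_1v_1+\cdots+u_{m-1}v_{m-1}-u_mv_m$. Identify $\mathbb{R}^{2+m}_1=\mathbb{R}^2\oplus\mathbb{R}^m_1$, where $\mathbb{R}^2$ carries the Euclidean inner product. For smooth $f:\mathbb{R}^2\to\mathbb{R}^m_1$, the entire graph generated by $f$ is $M=\{(x,f(x)):x\in\mathbb{R}^2\}\subset\mathbb{R}^{2+m}_1$. Put $p=\partial f/\partial x_1$, $q=\partial f/\partial x_2$. The induced metric on $M$ in the global coordinates $(x_1,x_2)$ is $g=g_{ij}dx_idx_j$ with $g_{11}=1+\langle p,p\rangle$, $g_{22}=1+\langle q,q\rangle$, $g_{12}=g_{21}=\langle p,q\rangle$. $M$ is spacelike if $(g_{ij})$ is positive definite at every point; then $W:=\det(g_{ij})^{1/2}>0$, a function on $\mathbb{R}^2$. A spacelike surface is stationary if its mean curvature vector field vanishes identically; equivalently, all coordinate functions of $\mathbb{R}^{2+m}_1$ restricted to $M$ are harmonic for the Laplace–Beltrami operator $\Delta F=W^{-1}\partial_i(Wg^{ij}\partial_jF)$ of $g$, where $(g^{ij})=(g_{ij})^{-1}$.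 *)

(* Defs.v *)
From HB Require Import structures.
From mathcomp Require Import all_boot all_order all_algebra.
From mathcomp Require Import all_classical all_reals all_analysis.

Set Implicit Arguments.
Unset Strict Implicit.
Unset Printing Implicit Defensive.

Import Order.TTheory GRing.Theory Num.Theory.
Import numFieldNormedType.Exports.

Local Open Scope classical_set_scope.
Local Open Scope ring_scope.

Section Calculus.
Variables (R : realType) (k n : nat).
Implicit Type F : 'rV[R]_k -> 'rV[R]_n.

Definition partial (i : 'I_k) F : 'rV[R]_k -> 'rV[R]_n :=
  fun x => 'D_(delta_mx 0 i) F x.

(* differentiable is Frechet differentiability; Ck r F says that F is C^r. *)
Fixpoint Ck (r : nat) F : Prop :=
  if r is r'.+1 then
    (forall x, differentiable F x) /\ (forall i, Ck r' (partial i F))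
  else continuous F.

Definition smooth F : Prop := forall r, Ck r F.

End Calculus.

(* The Minkowski inner product on R^n_1: the last coordinate is timelike. *)
Definition mink (R : realType) (n : nat) (u v : 'rV[R]_n) : R :=
  \sum_(i < n) (if i.+1 == n then -1 else 1) * (u 0 i * v 0 i).

(* Geometry of a parametrized surface X : R^2 -> R^n_1. *)
Section Surface.
Variables (R : realType) (n : nat).
Implicit Type X : 'rV[R]_2 -> 'rV[R]_n.

Definition metric X (x : 'rV[R]_2) : 'M[R]_2 :=
  \matrix_(i, j) mink (partial i X x) (partial j X x).

Definition spacelike X : Prop :=
  forall x (v : 'rV[R]_2), v != 0 -> 0 < (v *m metric X x *m v^T) 0 0.

Definition Wfun X (x : 'rV[R]_2) : R := Num.sqrt (\det (metric X x)).

Definition tangent_part X (x : 'rV[R]_2) (v : 'rV[R]_n) : 'rV[R]_n :=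
  \sum_(i < 2) \sum_(j < 2)
    (invmx (metric X x) i j * mink v (partial j X x)) *: partial i X x.

Definition normal_part X (x : 'rV[R]_2) (v : 'rV[R]_n) : 'rV[R]_n :=
  v - tangent_part X x v.

(* The ambient space is flat, so B(d_i, d_j) is the normal part of d_i d_j X. *)
Definition second_form X (i j : 'I_2) (x : 'rV[R]_2) : 'rV[R]_n :=
  normal_part X x (partial i (partial j X) x).

Definition mean_curvature X (x : 'rV[R]_2) : 'rV[R]_n :=
  2^-1 *: \sum_(i < 2) \sum_(j < 2)
    invmx (metric X x) i j *: second_form X i j x.

Definition stationary X : Prop := forall x, mean_curvature X x = 0.

End Surface.

(* R^(2+m)_1 = R^2 (+) R^m_1; for 0 < m, the timelike coordinate of 'rV_(2 + m)
   singled out by mink is the last one of the second summand. *)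
Definition graph (R : realType) (m : nat) (f : 'rV[R]_2 -> 'rV[R]_m) :
    'rV[R]_2 -> 'rV[R]_(2 + m) :=
  fun x => row_mx x (f x).

Section Graph.
Variables (R : realType) (m : nat) (f : 'rV[R]_2 -> 'rV[R]_m).

Lemma partial_graph (i : 'I_2) x : differentiable f x ->
  partial i (graph f) x = row_mx (delta_mx 0 i) (partial i f x).
Proof.
move=> df; have dfi : derivable f x (delta_mx 0 i) by exact/diff_derivable.
have dl k : is_derive x (delta_mx 0 i) (fun y : 'rV[R]_2 => y 0 k)
    ((delta_mx 0 i : 'rV[R]_2) 0 k).
  have dc : differentiable (fun y : 'rV[R]_2 => y 0 k) x.
    exact: differentiable_coord.
  apply: DeriveDef; first exact: diff_derivable.
  rewrite deriveE // /=.
  pose c := fun y : 'rV[R]_2 => y 0 k.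
  have lc : linear c by move=> a u v; rewrite /c !mxE.
  pose lcM := GRing.isLinear.Build _ _ _ _ c lc.
  pose cL : {linear 'rV[R]_2 -> R} := HB.pack c lcM.
  have -> : (fun y : 'rV[R]_2 => y 0 k) = cL by [].
  by rewrite diff_lin //; exact: coord_continuous.
have E1 (k : 'I_2) :
    (fun y => graph f y 0 (lshift m k)) = (fun y => y 0 k).
  by apply/funext => y; rewrite /graph row_mxEl.
have E2 (k : 'I_m) :
    (fun y => graph f y 0 (rshift 2 k)) = (fun y => f y 0 k).
  by apply/funext => y; rewrite /graph row_mxEr.
have dX : derivable (graph f) x (delta_mx 0 i).
  apply/derivable_mxP => a b; rewrite (ord1 a).
  case: (split_ordP b) => k ->; first by rewrite E1; have [] := dl k.
  by rewrite E2; move/derivable_mxP : dfi.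
rewrite /partial derive_mx //; apply/rowP => b; rewrite mxE.
case: (split_ordP b) => k ->.
  by rewrite E1 row_mxEl; have [_ ->] := dl k.
by rewrite E2 row_mxEr derive_mx // mxE.
Qed.

Lemma mink_row_mx (u1 v1 : 'rV[R]_2) (u2 v2 : 'rV[R]_m) : (0 < m)%N ->
  mink (row_mx u1 u2) (row_mx v1 v2) =
  \sum_(i < 2) u1 0 i * v1 0 i + mink u2 v2.
Proof.
move=> m0; rewrite /mink big_split_ord /=; congr (_ + _).
  apply: eq_bigr => i _; rewrite !row_mxEl ifF ?mul1r //.
  by apply/ltn_eqF/(leq_ltn_trans (ltn_ord i)); rewrite -[ltnLHS]addn0 ltn_add2l.
by apply: eq_bigr => i _; rewrite !row_mxEr /= -addnS eqn_add2l.
Qed.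

Lemma metric_graph x : (0 < m)%N -> differentiable f x ->
  metric (graph f) x =
  \matrix_(i, j) ((i == j)%:R + mink (partial i f x) (partial j f x)).
Proof.
move=> m0 df; apply/matrixP => i j.
rewrite !mxE !partial_graph // mink_row_mx //; congr (_ + _).
rewrite (bigD1 i) //= big1 ?addr0 => [|k ki]; rewrite !mxE.
  by rewrite !eqxx mul1r.
by rewrite (negbTE ki) andbF mul0r.
Qed.

End Graph.

(* Main.v *)
(** In the isothermal coordinates (x_1, x_2 / b) the coordinate functions of a
    stationary graph are harmonic, so their complex derivatives phi_k are
    holomorphic with sum of signed squares 0. Taking phi_1 = 1, phi_2 = - i b,
    phi_4 = s constant and the null combinations phi_3 - phi_5, phi_3 + phi_5
    proportional to e^z and e^-z, the signed sum of the |phi_k|^2 oscillates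
    with Im z but stays bounded. With s^2 = C - 1 this gives a W-function whose
    range is [C / b, b], and it remains to take b slightly above sqrt C. *)

From HB Require Import structures.
Require Import Defs.
From mathcomp Require Import all_boot all_order all_algebra.
From mathcomp Require Import all_classical all_reals all_analysis.
From mathcomp Require Import ring lra.
Set Implicit Arguments.
Unset Strict Implicit.
Unset Printing Implicit Defensive.
Import Order.TTheory GRing.Theory Num.Theory.
Import numFieldNormedType.Exports.
Local Open Scope classical_set_scope.
Local Open Scope ring_scope.

(** * Smoothness criteria and Fréchet differentials *)

Lemma ord2P (l : 'I_2) : l = 0 \/ l = 1.
Proof. by case: l => -[|[|]] // H; [left|right]; exact: val_inj. Qed.

(** Closure under [partial] lets the induction on the order run over the whole family at once, so no
    higher derivative has to be computed. *)
Lemma smooth_family (R : realType) (k n : nat)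
    (S : ('rV[R]_k -> 'rV[R]_n) -> Prop) :
  (forall F, S F -> forall x, differentiable F x) ->
  (forall F, S F -> forall i, S (partial i F)) ->
  forall F, S F -> smooth F.
Proof.
move=> dS pS F SF r; elim: r F SF => [|r IH] F SF.
  by move=> x; apply: differentiable_continuous; exact: dS.
by split; [exact: dS|move=> i; apply: IH; exact: pS].
Qed.

Lemma is_diff_comp_real (R : realType) (V : normedModType R) (h dh : V -> R)
    (g : R -> R) (g' : R) (x : V) :
  is_diff x h dh -> is_derive (h x) 1 g g' ->
  is_diff x (g \o h) (fun v => dh v * g').
Proof.
move=> hd [gd gv]; have {}gd : differentiable g (h x) by apply/derivable1_diffP.
have dg : is_diff (h x) g (fun t => t * g').
  by apply: DiffDef => //; rewrite diff1E // derive1E gv.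
exact: is_diff_comp.
Qed.

Lemma is_diff_scale_cst (R : realType) (V W : normedModType R) (h dh : V -> R)
    (w : W) (x : V) :
  is_diff x h dh -> is_diff x (fun y => h y *: w) (fun v => dh v *: w).
Proof.
move=> hd.
exact: (@is_diff_comp _ _ _ _ h dh ( *:%R ^~ w) ( *:%R ^~ w)).
Qed.

Lemma is_diff_coord (R : realType) (k : nat) (i : 'I_k) (x : 'rV[R]_k) :
  is_diff x (fun y : 'rV[R]_k => y 0 i) (fun v => v 0 i).
Proof.
apply: DiffDef; first exact: differentiable_coord.
pose c := fun y : 'rV[R]_k => y 0 i.
have lc : linear c by move=> a u v; rewrite /c !mxE.
pose lcM := GRing.isLinear.Build _ _ _ _ c lc.
pose cL : {linear 'rV[R]_k -> R} := HB.pack c lcM.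
have -> : (fun y : 'rV[R]_k => y 0 i) = cL by [].
by rewrite diff_lin //; exact: coord_continuous.
Qed.

(** * Exponential waves with an affine part *)

Section Wave.
Variables (R : realType) (n : nat) (w : R).
Implicit Types (a b c d p q r : 'rV[R]_n) (x : 'rV[R]_2).

(* As the vector coefficients vary, this family is closed under partial, hence
   consists of smooth functions. *)
Definition wave a b c d p q r x : 'rV[R]_n :=
  (expR (x 0 0) * cos (w * x 0 1)) *: a + (expR (x 0 0) * sin (w * x 0 1)) *: b
  + ((expR (- x 0 0) * cos (w * x 0 1)) *: c
    + (expR (- x 0 0) * sin (w * x 0 1)) *: d)
  + (x 0 0 *: p + x 0 1 *: q + r).

(** The first partial flips the sign of the [expR (- x 0 0)] terms, the second turns each
    cosine-sine pair by a quarter and scales it by [w]. Writing both as waves lets the partials be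
    read off at the basis vectors. *)
Lemma is_diff_wave a b c d p q r x :
  is_diff x (wave a b c d p q r)
    (fun v => v 0 0 *: wave a b (- c) (- d) 0 0 p x
      + v 0 1 *: wave (w *: b) (- w *: a) (w *: d) (- w *: c) 0 0 q x).
Proof.
have d0 := is_diff_coord (R := R) 0 x; have d1 := is_diff_coord (R := R) 1 x.
have de : is_diff x (fun y : 'rV[R]_2 => expR (y 0 0))
   (fun v => v 0 0 * expR (x 0 0)) by exact: is_diff_comp_real.
have dne : is_diff x (fun y : 'rV[R]_2 => expR (- y 0 0))
   (fun v => - v 0 0 * expR (- x 0 0)).
  apply: (@is_diff_comp_real R _ (fun y : 'rV[R]_2 => - y 0 0)
    (fun v => - v 0 0)); exact: is_diffN.
have dw : is_diff x (fun y : 'rV[R]_2 => w * y 0 1) (fun v => w * v 0 1).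
  exact: is_diffZ.
have dc : is_diff x (fun y : 'rV[R]_2 => cos (w * y 0 1))
   (fun v => w * v 0 1 * - sin (w * x 0 1)) by exact: is_diff_comp_real.
have ds : is_diff x (fun y : 'rV[R]_2 => sin (w * y 0 1))
   (fun v => w * v 0 1 * cos (w * x 0 1)) by exact: is_diff_comp_real.
have D := is_diffD (is_diffD (is_diffD
    (is_diff_scale_cst a (is_diffM de dc))
    (is_diff_scale_cst b (is_diffM de ds)))
  (is_diffD
    (is_diff_scale_cst c (is_diffM dne dc))
    (is_diff_scale_cst d (is_diffM dne ds))))
  (is_diffD (is_diffD (is_diff_scale_cst p d0) (is_diff_scale_cst q d1))
     (is_diff_cst r x)).
apply: (is_diff_eq D); apply/funext => v; apply/rowP => i.
rewrite /wave !fctE !mxE /GRing.scale /=; ring.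
Qed.

Lemma partial_wave0 a b c d p q r :
  partial 0 (wave a b c d p q r) = wave a b (- c) (- d) 0 0 p.
Proof.
apply/funext => x; have D := is_diff_wave a b c d p q r x.
by rewrite /partial deriveE // diff_val !mxE /= scale1r scale0r addr0.
Qed.

Lemma partial_wave1 a b c d p q r : partial 1 (wave a b c d p q r) =
  wave (w *: b) (- w *: a) (w *: d) (- w *: c) 0 0 q.
Proof.
apply/funext => x; have D := is_diff_wave a b c d p q r x.
by rewrite /partial deriveE // diff_val !mxE /= scale1r scale0r add0r.
Qed.

Lemma smooth_wave a b c d p q r : smooth (wave a b c d p q r).
Proof.
apply: (@smooth_family R 2 n
  (fun F => exists a b c d p q r, F = wave a b c d p q r)); last first.
- by exists a, b, c, d, p, q, r.
- move=> _ [a' [b' [c' [d' [p' [q' [r' ->]]]]]]] i.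
  have [->|->] := ord2P i.
  + by rewrite partial_wave0; do 7 eexists.
  + by rewrite partial_wave1; do 7 eexists.
- move=> _ [a' [b' [c' [d' [p' [q' [r' ->]]]]]]] x.
  by have D := is_diff_wave a' b' c' d' p' q' r' x.
Qed.

End Wave.

(** * Minkowski products, and mean curvature for a diagonal metric *)

Lemma invmx_diag (F : fieldType) (n : nat) (d : 'rV[F]_n) :
  (forall i, d 0 i != 0) -> invmx (diag_mx d) = diag_mx (map_mx GRing.inv d).
Proof.
move=> d0; have dV : diag_mx d *m diag_mx (map_mx GRing.inv d) = 1%:M.
  rewrite mulmx_diag; apply/matrixP => i j; rewrite !mxE.
  by case: eqP => // _; rewrite mulfV.
have [du _] := mulmx1_unit dV.
by rewrite -[LHS]mulmx1 -dV mulKmx.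
Qed.

Section Mink.
Variables (R : realType) (n : nat).
Implicit Types u v : 'rV[R]_n.

Lemma mink_linear a u u' v : mink (a *: u + u') v = a * mink u v + mink u' v.
Proof.
rewrite /mink mulr_sumr -big_split /=; apply: eq_bigr => i _.
rewrite !mxE; ring.
Qed.

Lemma minkC u v : mink u v = mink v u.
Proof. by apply: eq_bigr => i _; rewrite [u _ _ * _]mulrC. Qed.

Lemma minkDr u v v' : mink u (v + v') = mink u v + mink u v'.
Proof.
by rewrite minkC -[v]scale1r mink_linear mul1r scale1r !(minkC u).
Qed.

Lemma minkZr a u v : mink u (a *: v) = a * mink u v.
Proof.
rewrite minkC -[a *: v]addr0 mink_linear (minkC v) [mink 0 u]big1 ?addr0 //.
by move=> i _; rewrite mxE mul0r mulr0.
Qed.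

Lemma mink_delta u (j : 'I_n) :
  mink u (delta_mx 0 j) = (if j.+1 == n then -1 else 1) * u 0 j.
Proof.
rewrite /mink (bigD1 j) //= big1 ?addr0 => [|i ij].
  by rewrite !mxE !eqxx mulr1.
by rewrite !mxE (negbTE ij) andbF !mulr0.
Qed.

Lemma mink_plane (i j k : 'I_n) (a b c a' b' c' : R) :
  [/\ i != j, i != k & j != k] -> k.+1 = n ->
  mink (a *: delta_mx 0 i + b *: delta_mx 0 j + c *: delta_mx 0 k)
       (a' *: delta_mx 0 i + b' *: delta_mx 0 j + c' *: delta_mx 0 k)
  = a * a' + b * b' - c * c'.
Proof.
move=> [ij ik jk] kn.
have last (l : 'I_n) : (l.+1 == n) = (l == k) by rewrite -[X in _ == X]kn eqSS.
rewrite !minkDr !minkZr !mink_delta !last !eqxx.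
rewrite (negbTE ik) (negbTE jk).
rewrite !mxE !eqxx [k == i]eq_sym [k == j]eq_sym [j == i]eq_sym.
rewrite (negbTE ij) (negbTE ik) (negbTE jk) /=; ring.
Qed.

End Mink.

Lemma normal_part_is_linear (R : realType) (n : nat)
    (X : 'rV[R]_2 -> 'rV[R]_n) (x : 'rV[R]_2) : linear (normal_part X x).
Proof.
move=> a u v; rewrite /normal_part.
suff -> : tangent_part X x (a *: u + v) =
    a *: tangent_part X x u + tangent_part X x v.
  by rewrite scalerBr opprD addrACA.
rewrite /tangent_part !scaler_sumr -big_split /=; apply: eq_bigr => i _.
rewrite !scaler_sumr -big_split /=; apply: eq_bigr => j _.
by rewrite mink_linear mulrDr scalerDl scalerA mulrCA.
Qed.

(** The normal projection is linear, so it can be taken after the trace of the second derivatives;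
    if the trace already vanishes, no projection has to be computed. *)
Lemma mean_curvature_diag (R : realType) (n : nat) (X : 'rV[R]_2 -> 'rV[R]_n)
    (x d : 'rV[R]_2) :
  metric X x = diag_mx d -> (forall i, d 0 i != 0) ->
  \sum_(i < 2) (d 0 i)^-1 *: partial i (partial i X) x = 0 ->
  mean_curvature X x = 0.
Proof.
move=> Xd d0 dX; rewrite /mean_curvature Xd invmx_diag //.
pose lN := GRing.isLinear.Build _ _ _ _ _ (normal_part_is_linear X x).
pose N : {linear 'rV[R]_n -> 'rV[R]_n} := HB.pack (normal_part X x) lN.
have N0 : N (\sum_(i < 2) (d 0 i)^-1 *: partial i (partial i X) x) = 0.
  by rewrite dX linear0.
transitivity (2^-1 *: 0 : 'rV[R]_n); last exact: scaler0.
congr (_ *: _); rewrite -[RHS]N0 linear_sum.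
apply: eq_bigr => i _; rewrite (bigD1 i) //= big1 ?addr0 => [|j ji].
  rewrite !mxE eqxx; exact/esym/(linearZ_LR N).
by rewrite !mxE eq_sym (negbTE ji) scale0r.
Qed.

(** * Attained infima and suprema *)

Lemma inf_attained (R : realType) (A : set R) (x : R) :
  A x -> lbound A x -> inf A = x.
Proof.
move=> Ax xA; apply/le_anti; rewrite ge_inf //=; last by exists x.
by apply: lb_le_inf => //; exists x.
Qed.

Lemma sup_attained (R : realType) (A : set R) (x : R) :
  A x -> ubound A x -> sup A = x.
Proof.
move=> Ax xA; apply/le_anti; rewrite ge_sup //=; last by exists x.
by apply: ub_le_sup => //; exists x.
Qed.

(** * Graphs of waves *)

Lemma wave_row_mx (R : realType) (n1 n2 : nat) (w : R)
    (a b c d p q r : 'rV[R]_n1) (a' b' c' d' p' q' r' : 'rV[R]_n2) x :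
  wave w (row_mx a a') (row_mx b b') (row_mx c c') (row_mx d d')
    (row_mx p p') (row_mx q q') (row_mx r r') x =
  row_mx (wave w a b c d p q r x) (wave w a' b' c' d' p' q' r' x).
Proof. by rewrite /wave !scale_row_mx !add_row_mx. Qed.

(** The identity of the plane is a wave with only a linear part, so the graph stays in the family
    and its second derivatives come from the same two rules. *)
Lemma graph_wave (R : realType) (m : nat) (w : R)
    (a b c d p q r : 'rV[R]_m) :
  graph (wave w a b c d p q r) =
  wave w (row_mx 0 a) (row_mx 0 b) (row_mx 0 c) (row_mx 0 d)
    (row_mx (delta_mx 0 0) p) (row_mx (delta_mx 0 1) q) (row_mx 0 r).
Proof.
apply/funext => x; rewrite wave_row_mx /graph; congr row_mx.
rewrite /wave !scaler0 !addr0 add0r; apply/rowP => i; rewrite !mxE eqxx /=.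
have [->|->] := ord2P i.
- by rewrite mulr1 mulr0 addr0.
- by rewrite mulr1 mulr0 add0r.
Qed.

(** * The explicit surface, its metric and its W-function *)

Section WaveMap.
Variables (R : realType) (m : nat) (i j k : 'I_m) (C b : R).
Hypotheses (ijk : [/\ i != j, i != k & j != k]) (km : k.+1 = m).
Hypotheses (C1 : 1 <= C) (b0 : 0 < b) (Cb : C < b ^+ 2).

(** These values give [4 * h ^+ 2 = b ^+ 2 - C] and [1 + s ^+ 2 = C], which fix the extremes of the
    first metric coefficient at [C] and [b ^+ 2]. *)
Let h := Num.sqrt (b ^+ 2 - C) / 2.
Let s := Num.sqrt (C - 1).

(* (x, y) |-> (2 h sinh x cos (y / b), s x, 2 h cosh x cos (y / b)) in the
   coordinates i, j, k *)
Definition wave_map : 'rV[R]_2 -> 'rV[R]_m :=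
  wave b^-1 (h *: (delta_mx 0 i + delta_mx 0 k)) 0
    (h *: (delta_mx 0 k - delta_mx 0 i)) 0 (s *: delta_mx 0 j) 0 0.

(** The conformal factor of the induced metric in the isothermal coordinates; as a convex
    combination of [C] and [b ^+ 2] it lies between them. *)
Definition factor (x : 'rV[R]_2) : R :=
  C * sin (b^-1 * x 0 1) ^+ 2 + b ^+ 2 * cos (b^-1 * x 0 1) ^+ 2.

Lemma factorE x : factor x = C + (b ^+ 2 - C) * cos (b^-1 * x 0 1) ^+ 2.
Proof. by rewrite /factor sin2cos2; ring. Qed.

Lemma factor_ge x : C <= factor x.
Proof.
rewrite factorE lerDl mulr_ge0 ?sqr_ge0 // subr_ge0; exact: ltW.
Qed.

Lemma factor_le x : factor x <= b ^+ 2.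
Proof.
have -> : factor x = b ^+ 2 - (b ^+ 2 - C) * sin (b^-1 * x 0 1) ^+ 2.
  by rewrite /factor cos2sin2; ring.
by rewrite gerBl mulr_ge0 ?sqr_ge0 // subr_ge0 ltW.
Qed.

Lemma factor_gt0 x : 0 < factor x.
Proof. exact: lt_le_trans (lt_le_trans ltr01 C1) (factor_ge x). Qed.

(** The exponentials multiply null vectors, so their squares cancel and only the product
    [E * E' = 1] survives; hence no coefficient depends on the first variable. *)
Lemma metric_wave_map x : metric (graph wave_map) x =
  diag_mx (\row_l (if l == 0 then factor x else factor x / b ^+ 2)).
Proof.
have m0 : (0 < m)%N by rewrite -km.
(* Order 1 of smoothness yields the differentiability that [metric_graph] asks for. *)
have [/(_ x) dx _] := smooth_wave b^-1 (h *: (delta_mx 0 i + delta_mx 0 k)) 0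
    (h *: (delta_mx 0 k - delta_mx 0 i)) 0 (s *: delta_mx 0 j) 0 0 1%N.
rewrite metric_graph //.
set E := expR (x 0 0); set E' := expR (- x 0 0).
set c := cos (b^-1 * x 0 1); set t := sin (b^-1 * x 0 1).
have EE' : E * E' = 1 by rewrite /E /E' expRN mulfV // expR_eq0.
have f0 : partial 0 wave_map x = (h * c * (E + E')) *: delta_mx 0 i
    + s *: delta_mx 0 j + (h * c * (E - E')) *: delta_mx 0 k.
  rewrite /wave_map partial_wave0 /wave -/E -/E' -/c -/t; apply/rowP => l.
  rewrite !mxE; ring.
have f1 : partial 1 wave_map x = (- (b^-1 * h * t) * (E - E')) *: delta_mx 0 i
    + 0 *: delta_mx 0 j + (- (b^-1 * h * t) * (E + E')) *: delta_mx 0 k.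
  rewrite /wave_map partial_wave1 /wave -/E -/E' -/c -/t; apply/rowP => l.
  rewrite !mxE; ring.
have h2 : 4 * h ^+ 2 = b ^+ 2 - C.
  rewrite /h expr_div_n sqr_sqrtr; last by rewrite subr_ge0 ltW.
  by field.
have s2 : s ^+ 2 = C - 1 by rewrite /s sqr_sqrtr // subr_ge0.
have c2 : c ^+ 2 = 1 - t ^+ 2 by rewrite /c cos2sin2.
have bN : b != 0 by rewrite gt_eqF.
have enE : factor x = C + 4 * h ^+ 2 * c ^+ 2 by rewrite factorE h2.
have g00 : 1 + mink (partial 0 wave_map x) (partial 0 wave_map x) = factor x.
  rewrite f0 mink_plane // enE.
  transitivity (1 + s ^+ 2 + 4 * (E * E') * h ^+ 2 * c ^+ 2); first by ring.
  by rewrite EE' s2; ring.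
have g01 : mink (partial 0 wave_map x) (partial 1 wave_map x) = 0.
  rewrite f0 f1 mink_plane //; ring.
have g11 : 1 + mink (partial 1 wave_map x) (partial 1 wave_map x)
    = factor x / b ^+ 2.
  rewrite f1 mink_plane // enE.
  transitivity (1 - 4 * h ^+ 2 * (E * E') * t ^+ 2 / b ^+ 2); first by field.
  by rewrite EE' c2 h2; field.
apply/matrixP => u v; rewrite !mxE.
have [->|->] := ord2P u; have [->|->] := ord2P v; rewrite /= ?add0r.
- exact: g00.
- exact: g01.
- by rewrite minkC; exact: g01.
- exact: g11.
Qed.

Lemma spacelike_wave_map : spacelike (graph wave_map).
Proof.
move=> x v v0; rewrite metric_wave_map.
have -> :
    (v *m diag_mx (\row_l (if l == 0 then factor x else factor x / b ^+ 2))
      *m v^T) 0 0 = factor x * v 0 0 ^+ 2 + factor x / b ^+ 2 * v 0 1 ^+ 2.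
  rewrite mul_mx_diag !mxE big_ord_recl big_ord1 !mxE /=.
  rewrite (_ : lift ord0 ord0 = 1); last exact: val_inj.
  by rewrite /=; ring.
have e0 := factor_gt0 x.
have e1 : 0 < factor x / b ^+ 2 by rewrite divr_gt0 // exprn_gt0.
have p0 : 0 <= factor x * v 0 0 ^+ 2 by rewrite mulr_ge0 ?sqr_ge0 ?ltW.
have p1 : 0 <= factor x / b ^+ 2 * v 0 1 ^+ 2 by rewrite mulr_ge0 ?sqr_ge0 ?ltW.
rewrite lt0r addr_ge0 // andbT; apply: contra v0; rewrite paddr_eq0 //.
rewrite (mulf_eq0 (factor x)) (mulf_eq0 (factor x / b ^+ 2)).
rewrite (gt_eqF e0) (gt_eqF e1) !expf_eq0 /= => /andP[/eqP v00 /eqP v01].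
apply/eqP/rowP => l; rewrite mxE.
by have [->|->] := ord2P l.
Qed.

Lemma Wfun_wave_map x : Wfun (graph wave_map) x = factor x / b.
Proof.
rewrite /Wfun metric_wave_map det_diag big_ord_recl big_ord1 !mxE /=.
have -> : factor x * (factor x / b ^+ 2) = (factor x / b) ^+ 2.
  by field; rewrite gt_eqF.
by rewrite sqrtr_sqr ger0_norm // divr_ge0 // ltW // factor_gt0.
Qed.

(** Up to the factor [(factor x)^-1], the trace is the second derivative in x plus [b ^+ 2] times
    that in y. It vanishes because the waves have frequency [b^-1] and the remaining part is
    affine. *)
Lemma stationary_wave_map : stationary (graph wave_map).
Proof.
move=> x; apply: (mean_curvature_diag (metric_wave_map x)) => [l|].
  rewrite mxE gt_eqF //; case: ifP => _; first exact: factor_gt0.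
  by rewrite divr_gt0 ?factor_gt0 // exprn_gt0.
rewrite big_ord_recl big_ord1 !mxE /=.
rewrite (_ : lift ord0 ord0 = 1); last exact: val_inj.
rewrite graph_wave partial_wave0 partial_wave0 partial_wave1 partial_wave1.
apply/rowP => l; rewrite /wave !mxE.
field; rewrite !gt_eqF // factor_gt0 //.
Qed.

Lemma range_Wfun_wave_map : let W := range (Wfun (graph wave_map)) in
  [/\ W (C / b), W b, lbound W (C / b) & ubound W b].
Proof.
have bN : b != 0 by rewrite gt_eqF.
split.
(* Here the cosine vanishes and the factor is minimal; at the origin, used next, the cosine is 1 and
   the factor is maximal. *)
- exists ((b * (pi / 2)) *: delta_mx 0 1) => //.
  by rewrite Wfun_wave_map factorE !mxE mulr1 mulKf // cos_pihalf
    expr0n mulr0 addr0.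
- exists 0 => //.
  by rewrite Wfun_wave_map factorE !mxE mulr0 cos0; field.
- move=> _ [x _ <-]; rewrite Wfun_wave_map ler_pM2r ?invr_gt0 //.
  exact: factor_ge.
- move=> _ [x _ <-]; rewrite Wfun_wave_map ler_pdivrMr // -expr2.
  exact: factor_le.
Qed.

End WaveMap.

(** * Prescribing the product and the oscillation *)

Theorem proposition5p1 (R : realType) (m : nat) (hm : (3 <= m)%N)
    (C eps : R) (hC : 1 <= C) (heps : 0 < eps) :
  exists f : 'rV[R]_2 -> 'rV[R]_m,
    [/\ smooth f,
        spacelike (graph f),
        stationary (graph f) &
        let W := range (Wfun (graph f)) in
        [/\ has_inf W, has_sup W,
            inf W * sup W = C & 0 < sup W - inf W < eps]].
Proof.
(* Two spacelike axes and the timelike one, which must be the last. *)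
have [i [j [k [ijk km]]]] : exists i j k : 'I_m,
    [/\ i != j, i != k & j != k] /\ k.+1 = m.
  case: m hm => [|[|[|n]]] // _.
  by exists (inord 0), (inord 1), ord_max; split; [split|];
    rewrite // -val_eqE /= ?inordK.
have C0 : 0 <= C by apply: le_trans hC.
(* The gap [b - C / b] equals [eps / 4] times [(b + Num.sqrt C) / b], and the latter is below 2, so
   the gap is positive and less than [eps / 2]. *)
pose b := Num.sqrt C + eps / 4.
have sC : 1 <= Num.sqrt C by rewrite -sqrtr1 ler_wsqrtr.
have sC2 : Num.sqrt C ^+ 2 = C by rewrite sqr_sqrtr.
have b0 : 0 < b by rewrite /b; lra.
have Cb : C < b ^+ 2 by rewrite -sC2 /b; nra.
have [Wl Wu lW uW] := range_Wfun_wave_map ijk km hC b0 Cb.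
exists (wave_map i j k C b); split.
- exact: smooth_wave.
- exact: spacelike_wave_map.
- exact: stationary_wave_map.
move=> W; rewrite (inf_attained Wl lW) (sup_attained Wu uW); split.
- by split; exists (C / b).
- by split; exists b.
- by rewrite divfK // gt_eqF.
have -> : b - C / b = (b ^+ 2 - C) / b by field; rewrite gt_eqF.
rewrite divr_gt0 ?subr_gt0 //= ltr_pdivrMr // -sC2 /b; nra.
Qed.
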